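(* Let $\alpha\in(-1,1)$, $\beta^-,\beta^+>0$, $\xi,\eta\in\mathbb{R}$, let $f$ be a real-valued function on $\Omega^-\cup\Omega^+=(-1,\alpha)\cup(\alpha,1)$ and let $g:\mathbb{R}^2\to\mathbb{R}$. Let $u_0$ be the zero-jump component and $u_1$ the unit-jump response defined in the context. Then any solution $u$ of the nonlinear interface problem $$-(\beta u')'=f \ \text{ in } \Omega^-\cup\Omega^+,\qquad u(-1)=\xi,\quad u(1)=\eta,\qquad [\beta u']_\alpha=0,\qquad [u]_\alpha=g(u^+(\alpha),u^-(\alpha))$$ can be written as $$u=u_0+s\,u_1,$$ where the scalar $s\in\mathbb{R}$ satisfies the nonlinear equation $$s=g\big(u_0^+(\alpha)+s\,u_1^+(\alpha),\;u_0^-(\alpha)+s\,u_1^-(\alpha)\big).$$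
   Context: The domain is $\Omega=(-1,1)$ with interface point $\alpha\in(-1,1)$, $\Omega^-=(-1,\alpha)$, $\Omega^+=(\alpha,1)$. The coefficient is piecewise constant: $\beta(x)=\beta^-$ for $x<\alpha$ and $\beta(x)=\beta^+$ for $x>\alpha$, with $\beta^\pm>0$. For a function $v$ on $\Omega^-\cup\Omega^+$, $v^+(\alpha)$ and $v^-(\alpha)$ denote its one-sided limits (traces) at $\alpha$ from the right and from the left, and $[v]_\alpha=v^+(\alpha)-v^-(\alpha)$ is the jump; $[\beta v']_\alpha=\beta^+ (v')^+(\alpha)-\beta^-(v')^-(\alpha)$. Solutions are understood in the classical sense: a solution is twice differentiable in each of $\Omega^-$ and $\Omega^+$, satisfies the differential equation pointwise there, extends continuously to the endpoints $\pm1$, and it and its first derivative have one-sided limits at $\alpha$. The zero-jump component $u_0$ is the solution of $-(\beta u_0')'=f$ in $\Omega^-\cup\Omega^+$, $u_0(-1)=\xi$, $u_0(1)=\eta$, $[u_0]_\alpha=0$, $[\beta u_0']_\alpha=0$ (the data $f$ being such that it exists). The unit-jump response $u_1$ is the solution of $-(\beta u_1')'=0$ in $\Omega^-\cup\Omega^+$, $u_1(-1)=0$, $u_1(1)=0$, $[u_1]_\alpha=1$, $[\beta u_1']_\alpha=0$. *)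

(* Defs.v *)
From mathcomp Require Import all_boot all_order all_algebra.
From mathcomp Require Import all_classical all_reals all_analysis.

Set Implicit Arguments.
Unset Strict Implicit.
Unset Printing Implicit Defensive.

Import Order.TTheory GRing.Theory Num.Theory.
Import numFieldNormedType.Exports.

Local Open Scope classical_set_scope.
Local Open Scope ring_scope.

(* Functions on Omega^- `|` Omega^+ are represented by total functions R -> R;
   their values at alpha, at the endpoints and outside ]-1, 1[ are never used.
   In particular u(-1) and u(1) are the boundary values of the continuous
   extension, i.e., one-sided limits. *)

Definition Omegam (R : realType) (alpha : R) : set R := `]-1, alpha[.
Definition Omegap (R : realType) (alpha : R) : set R := `]alpha, 1[.

(* The value at alpha itself is an irrelevant convention. *)
Definition beta_coef (R : realType) (alpha betam betap x : R) : R :=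
  if x < alpha then betam else betap.

(* [lim] is only meaningful when the one-sided limit exists; the existence of
   all the limits used below is part of [classical_regular]. *)
Definition tracep (R : realType) (v : R -> R) (a : R) : R :=
  lim (v x @[x --> a^'+]).
Definition tracem (R : realType) (v : R -> R) (a : R) : R :=
  lim (v x @[x --> a^'-]).

Definition jump (R : realType) (v : R -> R) (a : R) : R :=
  tracep v a - tracem v a.

Definition flux_jump (R : realType) (alpha betam betap : R) (v : R -> R) : R :=
  betap * tracep (derive1 v) alpha - betam * tracem (derive1 v) alpha.

Definition classical_regular (R : realType) (alpha : R) (v : R -> R) : Prop :=
  [/\ forall x, (Omegam alpha `|` Omegap alpha) x ->
        derivable v x 1 /\ derivable (derive1 v) x 1,
      cvg (v x @[x --> (-1)^'+]) /\ cvg (v x @[x --> 1^'-]),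
      cvg (v x @[x --> alpha^'+]) /\ cvg (v x @[x --> alpha^'-]) &
      cvg (derive1 v x @[x --> alpha^'+]) /\ cvg (derive1 v x @[x --> alpha^'-])].

Definition interface_solution (R : realType) (alpha betam betap : R)
    (f : R -> R) (xi eta J : R) (v : R -> R) : Prop :=
  [/\ classical_regular alpha v,
      forall x, (Omegam alpha `|` Omegap alpha) x ->
        - derive1 (fun y => beta_coef alpha betam betap y * derive1 v y) x = f x,
      tracep v (-1) = xi /\ tracem v 1 = eta,
      flux_jump alpha betam betap v = 0 &
      jump v alpha = J].

Definition zero_jump_component (R : realType) (alpha betam betap : R)
    (f : R -> R) (xi eta : R) (u0 : R -> R) : Prop :=
  interface_solution alpha betam betap f xi eta 0 u0.

Definition unit_jump_response (R : realType) (alpha betam betap : R)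
    (u1 : R -> R) : Prop :=
  interface_solution alpha betam betap (fun=> 0) 0 0 1 u1.

Definition nonlinear_interface_solution (R : realType)
    (alpha betam betap : R) (f : R -> R) (xi eta : R) (g : R * R -> R)
    (u : R -> R) : Prop :=
  interface_solution alpha betam betap f xi eta
    (g (tracep u alpha, tracem u alpha)) u.

(* Main.v *)
Require Import Defs.
From mathcomp Require Import all_boot all_order all_algebra.
From mathcomp Require Import all_classical all_reals all_analysis.
From mathcomp Require Import ring lra.
Import Order.TTheory GRing.Theory Num.Theory.
Import numFieldNormedType.Exports.
Local Open Scope classical_set_scope.
Local Open Scope ring_scope.

(** Proof idea.  The interface problem with prescribed jump is linear in the
solution and in all its data (source, boundary values, jump), which is
[interface_solution_superposition].  Given a solution [u] of the nonlinear
problem, freeze the value [s] of [g] at the traces of [u]: then [u] solves the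
linear problem with prescribed jump [s], and so does [u0 + s * u1].  Hence
their difference solves the homogeneous problem, whose only solution is [0]
([interface_solution_homogeneous]): it is affine on each side of [alpha], and
vanishing boundary values, jump and flux jump form a nonsingular linear system
for the two slopes because [betam] and [betap] have the same sign.

The equation for [s] is then its own definition, once the traces of [u] are
rewritten as those of [u0 + s * u1]; this is legitimate because the two
functions agree on both sides of [alpha]. *)

(** * One-sided neighborhoods *)

Section OneSided.
Context {R : realType}.
Implicit Types (a b k l : R) (v w : R -> R).

Lemma near_right_itvoo {a b} : a < b -> \forall x \near a^'+, x \in `]a, b[.
Proof.
move=> ab; near=> x; rewrite in_itv /=; apply/andP; split; near: x.
  exact: nbhs_right_gt.
exact: nbhs_right_lt.
Unshelve. all: by end_near. Qed.

Lemma near_left_itvoo {a b} : a < b -> \forall x \near b^'-, x \in `]a, b[.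
Proof.
move=> ab; near=> x; rewrite in_itv /=; apply/andP; split; near: x.
  exact: nbhs_left_gt.
exact: nbhs_left_lt.
Unshelve. all: by end_near. Qed.

Lemma cvg_eq_near {F : set_system R} {FF : Filter F} {v w : R -> R} {l} :
  (\forall x \near F, v x = w x) ->
  v x @[x --> F] --> l -> w x @[x --> F] --> l.
Proof. by move=> vw; apply: cvg_trans; exact: near_eq_cvg. Qed.

Lemma cvg_lincomb {F : set_system R} {FF : Filter F} {v w} k :
  cvg (v x @[x --> F]) -> cvg (w x @[x --> F]) ->
  v x + k * w x @[x --> F] --> lim (v x @[x --> F]) + k * lim (w x @[x --> F]).
Proof. by move=> cv cw; apply: cvgD => //; exact: cvgMl_tmp. Qed.

Lemma tracepE {v a l} : v x @[x --> a^'+] --> l -> tracep v a = l.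
Proof. exact: cvg_lim. Qed.

Lemma tracemE {v a l} : v x @[x --> a^'-] --> l -> tracem v a = l.
Proof. exact: cvg_lim. Qed.

End OneSided.

(** * Functions with zero or constant derivative on an open interval *)

Section Affine.
Context {R : realType}.
Implicit Types (a b c d k : R) (v w : R -> R).

Lemma is_derive_lincomb {v w} {x : R} k :
  derivable v x 1 -> derivable w x 1 ->
  is_derive x 1 (fun y => v y + k * w y) (derive1 v x + k * derive1 w x).
Proof.
move=> dv dw; rewrite !derive1E.
have dv' : is_derive x 1 v ('D_1 v x) by exact/derivableP.
have dw' : is_derive x 1 w ('D_1 w x) by exact/derivableP.
exact: (is_deriveD dv' (is_deriveZ k dw')).
Qed.

Lemma derive1_lincomb {v w} {x : R} k :
  derivable v x 1 -> derivable w x 1 ->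
  derive1 (fun y => v y + k * w y) x = derive1 v x + k * derive1 w x.
Proof.
by move=> dv dw; rewrite derive1E; have [] := is_derive_lincomb k dv dw.
Qed.

Lemma derive1_eq0_cst {a b w} :
  {in `]a, b[, forall x, derivable w x 1 /\ derive1 w x = 0} ->
  exists d, {in `]a, b[, forall x, w x = d}.
Proof.
move=> dw; exists (w ((a + b) / 2)) => x xab.
have mab : (a + b) / 2 \in `]a, b[.
  by move: xab; rewrite !in_itv /= => /andP[ax xb]; apply/andP; split; lra.
have eqw (y z : R) : y \in `]a, b[ -> z \in `]a, b[ -> y <= z -> w y = w z.
  move=> yab zab yz.
  have sub (t : R) : t \in `[y, z] -> t \in `]a, b[.
    move: yab zab; rewrite !in_itv /= => /andP[ay _] /andP[_ zb] /andP[yt tz].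
    by rewrite (lt_le_trans ay yt) (le_lt_trans tz zb).
  have dwt (t : R) : t \in `]y, z[ -> is_derive t 1 w (derive1 w t).
    move=> /subset_itv_oo_cc/sub/dw[dwt _].
    by rewrite derive1E; exact/derivableP.
  have cw : {within `[y, z], continuous w}.
    by apply: derivable_within_continuous => t /sub/dw[].
  have [t /sub/dw[_ ->]] := MVT_segment yz dwt cw.
  by rewrite mul0r => /eqP; rewrite subr_eq0 => /eqP.
by case: (leP x ((a + b) / 2)) => [|/ltW] h; [exact: eqw | apply/esym/eqw].
Qed.

Lemma derive1_eq_cst_affine {a b c w} :
  {in `]a, b[, forall x, derivable w x 1 /\ derive1 w x = c} ->
  exists d, {in `]a, b[, forall x, w x = c * x + d}.
Proof.
move=> dw.
have [|d wd] := @derive1_eq0_cst a b (fun x => w x + - c * x).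
  move=> x /dw[dwx wxc].
  have did := @derivable_id _ _ x 1; split.
    by have [] := is_derive_lincomb (- c) dwx did.
  have dE : derive1 (fun y => w y + - c * y) x =
      derive1 w x + - c * derive1 id x := derive1_lincomb (- c) dwx did.
  by rewrite dE derive1_id wxc mulr1 subrr.
by exists d => x /wd <-; ring.
Qed.

Lemma derive1_derive1_eq0_affine {a b w} :
  {in `]a, b[, forall x, [/\ derivable w x 1, derivable (derive1 w) x 1 &
                          derive1 (derive1 w) x = 0]} ->
  exists c d, {in `]a, b[, forall x, derive1 w x = c /\ w x = c * x + d}.
Proof.
move=> dw; have [|c wc] := @derive1_eq0_cst a b (derive1 w).
  by move=> x /dw[].
have [|d wd] := @derive1_eq_cst_affine a b c w.
  by move=> x xab; have [dwx _ _] := dw x xab; split => //; exact: wc.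
by exists c, d => x xab; split; [exact: wc | exact: wd].
Qed.

Lemma cvg_affine {a c d} : c * x + d @[x --> a] --> c * a + d.
Proof. by apply: cvgD; [apply: cvgMl_tmp; exact: cvg_id | exact: cvg_cst]. Qed.

End Affine.

(** * The linear interface problem *)

Section Interface.
Context {R : realType} {alpha betam betap : R}.
Implicit Types (k xi eta J : R) (f v w : R -> R).

Lemma near_Omega {x : R} : (Omegam alpha `|` Omegap alpha) x ->
  \forall y \near x, (Omegam alpha `|` Omegap alpha) y.
Proof.
by move=> Ox; apply: open_nbhs_nbhs; split => //; apply: openU;
  exact: itv_open.
Qed.

(** [alpha] being outside the two open subdomains, the coefficient is locally
constant there and comes out of the derivative. *)
Lemma derive1_flux {v} {x : R} :
  (Omegam alpha `|` Omegap alpha) x -> derivable (derive1 v) x 1 ->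
  derive1 (fun y => beta_coef alpha betam betap y * derive1 v y) x =
  beta_coef alpha betam betap x * derive1 (derive1 v) x.
Proof.
move=> Ox dv; rewrite -derive1Ml// !derive1E; apply: near_eq_derive.
rewrite /beta_coef; case: Ox; rewrite /Omegam/Omegap/= in_itv/=.
  move=> /andP[_ xa]; near=> y; rewrite xa.
  suff -> : y < alpha by [].
  by near: y; exact: lt_nbhsl.
move=> /andP[ax _]; near=> y; rewrite (lt_gtF ax).
suff /lt_gtF -> : alpha < y by [].
by near: y; exact: lt_nbhsr.
Unshelve. all: by end_near. Qed.

Hypothesis halpha : -1 < alpha < 1.

Lemma near_right_Omega :
  \forall x \near alpha^'+, (Omegam alpha `|` Omegap alpha) x.
Proof.
by case/andP: halpha => _ /near_right_itvoo; apply: filterS => x; right.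
Qed.

Lemma near_left_Omega :
  \forall x \near alpha^'-, (Omegam alpha `|` Omegap alpha) x.
Proof.
by case/andP: halpha => /near_left_itvoo + _; apply: filterS => x; left.
Qed.

(** [derive1] is a total operator, additive only where its arguments are
differentiable; so the first derivative of the combination is the combination of the first
derivatives on the subdomains only.  As these are open and abut [alpha], this
is enough for second derivatives and for one-sided limits at [alpha]. *)
Lemma interface_solution_superposition {f1 f2 : R -> R}
    {xi1 xi2 eta1 eta2 J1 J2 : R} {v1 v2 : R -> R} (k : R) :
  interface_solution alpha betam betap f1 xi1 eta1 J1 v1 ->
  interface_solution alpha betam betap f2 xi2 eta2 J2 v2 ->
  interface_solution alpha betam betap (fun x => f1 x + k * f2 x)
    (xi1 + k * xi2) (eta1 + k * eta2) (J1 + k * J2) (fun x => v1 x + k * v2 x).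
Proof.
move=> [[dv1 [l1 r1] [ap1 am1] [dp1 dm1]] eq1 [<- <-] flux1 <-].
move=> [[dv2 [l2 r2] [ap2 am2] [dp2 dm2]] eq2 [<- <-] flux2 <-].
set v := fun x => v1 x + k * v2 x.
have dvE (x : R) : (Omegam alpha `|` Omegap alpha) x ->
    derive1 v1 x + k * derive1 v2 x = derive1 v x.
  move=> Ox; have [dv1x _] := dv1 x Ox; have [dv2x _] := dv2 x Ox.
  exact: esym (derive1_lincomb k dv1x dv2x).
have ddv (x : R) : (Omegam alpha `|` Omegap alpha) x ->
    is_derive x 1 (derive1 v)
      (derive1 (derive1 v1) x + k * derive1 (derive1 v2) x).
  move=> Ox; have [_ ddv1] := dv1 x Ox; have [_ ddv2] := dv2 x Ox.
  apply: near_eq_is_derive (is_derive_lincomb k ddv1 ddv2).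
  by apply: filterS (near_Omega Ox) => y; exact: dvE.
have cvp : v x @[x --> alpha^'+] --> tracep v1 alpha + k * tracep v2 alpha.
  exact: (cvg_lincomb k ap1 ap2).
have cvm : v x @[x --> alpha^'-] --> tracem v1 alpha + k * tracem v2 alpha.
  exact: (cvg_lincomb k am1 am2).
have cvl : v x @[x --> (-1)^'+] --> tracep v1 (-1) + k * tracep v2 (-1).
  exact: (cvg_lincomb k l1 l2).
have cvr : v x @[x --> 1^'-] --> tracem v1 1 + k * tracem v2 1.
  exact: (cvg_lincomb k r1 r2).
have cdp : derive1 v x @[x --> alpha^'+] -->
    tracep (derive1 v1) alpha + k * tracep (derive1 v2) alpha.
  exact: cvg_eq_near (filterS dvE near_right_Omega) (cvg_lincomb k dp1 dp2).
have cdm : derive1 v x @[x --> alpha^'-] -->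
    tracem (derive1 v1) alpha + k * tracem (derive1 v2) alpha.
  exact: cvg_eq_near (filterS dvE near_left_Omega) (cvg_lincomb k dm1 dm2).
split.
- split; last 3 first.
  + by split; apply: cvgP; [exact: cvl | exact: cvr].
  + by split; apply: cvgP; [exact: cvp | exact: cvm].
  + by split; apply: cvgP; [exact: cdp | exact: cdm].
  move=> x Ox; have [dv1x _] := dv1 x Ox; have [dv2x _] := dv2 x Ox.
  by split; [case: (is_derive_lincomb k dv1x dv2x)|case: (ddv x Ox)].
- move=> x Ox; rewrite -(eq1 x Ox) -(eq2 x Ox).
  have [_ ddv1] := dv1 x Ox; have [_ ddv2] := dv2 x Ox.
  have [ddvx ddvE] := ddv x Ox.
  rewrite (derive1_flux Ox ddv1) (derive1_flux Ox ddv2) (derive1_flux Ox ddvx).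
  have -> : derive1 (derive1 v) x =
      derive1 (derive1 v1) x + k * derive1 (derive1 v2) x by rewrite derive1E.
  by rewrite mulrDr opprD mulrN mulrCA.
- by split; [rewrite (tracepE cvl) | rewrite (tracemE cvr)].
- rewrite /flux_jump (tracepE cdp) (tracemE cdm).
  move/subr0_eq: flux1 => e1; move/subr0_eq: flux2 => e2.
  by apply/eqP; rewrite subr_eq0 !mulrDr ![_ * (k * _)]mulrCA e1 e2.
- rewrite /jump (tracepE cvp) (tracemE cvm); ring.
Qed.

Hypotheses (hbetam : 0 < betam) (hbetap : 0 < betap).

(** The equation makes [w] affine with slope [cm] on the left and [cp] on the
right.  The boundary values and the jump give [cm * (alpha + 1) =
cp * (alpha - 1)], so [cm] and [cp] have opposite signs, whereas the flux
condition [betap * cp = betam * cm] gives them equal signs: both vanish. *)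
Lemma interface_solution_homogeneous w :
  interface_solution alpha betam betap (fun=> 0) 0 0 0 w ->
  forall x, (Omegam alpha `|` Omegap alpha) x -> w x = 0.
Proof.
move=> [[dw _ _ _] eqw [wl wr] flux jmp].
have [am1 ap1] := andP halpha.
have ddw0 (x : R) : (Omegam alpha `|` Omegap alpha) x ->
    [/\ derivable w x 1, derivable (derive1 w) x 1 &
      derive1 (derive1 w) x = 0].
  move=> Ox; have [dwx ddwx] := dw x Ox; split => //.
  move: (eqw x Ox); rewrite derive1_flux// => /eqP.
  rewrite oppr_eq0 mulf_eq0 => /orP[|/eqP//].
  by rewrite /beta_coef; case: ifP => _; rewrite gt_eqF.
have [cm [dm wm]] : exists c d, {in `]-1, alpha[, forall x,
    derive1 w x = c /\ w x = c * x + d}.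
  by apply: derive1_derive1_eq0_affine => x xm; apply: ddw0; left.
have [cp [dp wp]] : exists c d, {in `]alpha, 1[, forall x,
    derive1 w x = c /\ w x = c * x + d}.
  by apply: derive1_derive1_eq0_affine => x xp; apply: ddw0; right.
have nm1 := near_right_itvoo am1; have nam := near_left_itvoo am1.
have nap := near_right_itvoo ap1; have n1 := near_left_itvoo ap1.
have twl : tracep w (-1) = cm * -1 + dm.
  apply/tracepE/(cvg_eq_near _ (cvg_at_right_filter cvg_affine)).
  by apply: filterS nm1 => x /wm[].
have twr : tracem w 1 = cp * 1 + dp.
  apply/tracemE/(cvg_eq_near _ (cvg_at_left_filter cvg_affine)).
  by apply: filterS n1 => x /wp[].
have twm : tracem w alpha = cm * alpha + dm.
  apply/tracemE/(cvg_eq_near _ (cvg_at_left_filter cvg_affine)).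
  by apply: filterS nam => x /wm[].
have twp : tracep w alpha = cp * alpha + dp.
  apply/tracepE/(cvg_eq_near _ (cvg_at_right_filter cvg_affine)).
  by apply: filterS nap => x /wp[].
have tdm : tracem (derive1 w) alpha = cm.
  apply/tracemE/(cvg_eq_near _ (@cvg_cst _ _ _ _ _)).
  by apply: filterS nam => x /wm[].
have tdp : tracep (derive1 w) alpha = cp.
  apply/tracepE/(cvg_eq_near _ (@cvg_cst _ _ _ _ _)).
  by apply: filterS nap => x /wp[].
move: flux jmp wl wr; rewrite /flux_jump /jump twl twr twm twp tdm tdp.
move=> flux jmp wl wr.
have dmE : dm = cm by lra.
have dpE : dp = - cp by lra.
have D0 : 0 < betap * (alpha + 1) + betam * (1 - alpha).
  by apply: addr_gt0; apply: mulr_gt0 => //; lra.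
have cm0 : cm = 0.
  have : cm * (betap * (alpha + 1) + betam * (1 - alpha)) = 0.
    have -> : cm * (betap * (alpha + 1) + betam * (1 - alpha)) =
      betap * (cm * (alpha + 1) + cp * (1 - alpha))
      - (1 - alpha) * (betap * cp - betam * cm) by ring.
    rewrite flux mulr0 subr0.
    suff -> : cm * (alpha + 1) + cp * (1 - alpha) = 0 by rewrite mulr0.
    by move: jmp; rewrite dmE dpE => jmp; lra.
  by move/eqP; rewrite mulf_eq0 (gt_eqF D0) orbF => /eqP.
have cp0 : cp = 0.
  move: flux; rewrite cm0 mulr0 subr0 => /eqP.
  by rewrite mulf_eq0 (gt_eqF hbetap) => /eqP.
move=> x [/wm[_ ->]|/wp[_ ->]].
  by rewrite dmE cm0 mul0r addr0.
by rewrite dpE cp0 oppr0 mul0r addr0.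
Qed.

Lemma interface_solution_unique {f : R -> R} {xi eta J : R} {v w : R -> R} :
  interface_solution alpha betam betap f xi eta J v ->
  interface_solution alpha betam betap f xi eta J w ->
  forall x, (Omegam alpha `|` Omegap alpha) x -> v x = w x.
Proof.
move=> hv hw x Ox.
have := interface_solution_superposition (-1) hv hw.
have -> : (fun y => f y + -1 * f y) = (fun=> 0).
  by apply/funext => y; rewrite mulN1r subrr.
rewrite !mulN1r !subrr => /interface_solution_homogeneous /(_ x Ox) /eqP.
by rewrite mulN1r subr_eq0 => /eqP.
Qed.

End Interface.

Theorem theorem2p2 (R : realType) (alpha betam betap xi eta : R)
    (f : R -> R) (g : R * R -> R) (u0 u1 u : R -> R)
    (halpha : -1 < alpha < 1) (hbetam : 0 < betam) (hbetap : 0 < betap)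
    (hu0 : zero_jump_component alpha betam betap f xi eta u0)
    (hu1 : unit_jump_response alpha betam betap u1)
    (hu : nonlinear_interface_solution alpha betam betap f xi eta g u) :
  exists s : R,
    (forall x, (Omegam alpha `|` Omegap alpha) x -> u x = u0 x + s * u1 x) /\
    s = g (tracep u0 alpha + s * tracep u1 alpha,
           tracem u0 alpha + s * tracem u1 alpha).
Proof.
set s := g (tracep u alpha, tracem u alpha).
have hv := interface_solution_superposition halpha s hu0 hu1.
have fE : (fun x => f x + s * 0) = f.
  by apply/funext => x; rewrite mulr0 addr0.
rewrite fE !mulr0 !addr0 mulr1 add0r in hv.
have uE := interface_solution_unique halpha hbetam hbetap hu hv.
exists s; split => //.
have vuE (x : R) : (Omegam alpha `|` Omegap alpha) x ->
    u0 x + s * u1 x = u x by move=> /uE.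
case: hu0 hu1 => [[_ _ [p0 m0] _] _ _ _ _] [[_ _ [p1 m1] _] _ _ _ _].
rewrite {1}/s; congr (g (_, _)).
  by apply/tracepE/(cvg_eq_near (filterS vuE (near_right_Omega halpha)));
    exact: cvg_lincomb.
by apply/tracemE/(cvg_eq_near (filterS vuE (near_left_Omega halpha)));
  exact: cvg_lincomb.
Qed.
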